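(* Let $\mathbf{D}$ be the finitary distribution monad and $\mathbf{M}$ the maybe monad on the category of sets. The normalization transformation $n_X=(-)^{\circ}\colon \mathbf{D}\mathbf{M}X\to\mathbf{M}\mathbf{D}X$ is not a distributive law of the monad $\mathbf{D}$ over the monad $\mathbf{M}$.
   Context: Distribution monad: $\mathbf{D}X$ is the set of finite formal sums $\sum_i\lambda_i|x_i\rangle$ with $x_i\in X$, $\lambda_i>0$, $\sum_i\lambda_i=1$; unit $\eta^{\mathbf D}(x)=|x\rangle$; multiplication $\mu^{\mathbf D}(\sum_i\lambda_i|\sum_j\mu_{ij}|x_{ij}\rangle\rangle)=\sum_{i,j}\lambda_i\mu_{ij}|x_{ij}\rangle$. Maybe monad: $\mathbf{M}X=X+\{\bot\}$, with unit the inclusion and multiplication $\mathbf{M}\mathbf{M}X=X+\{\bot_1\}+\{\bot_2\}\to \mathbf{M}X$ sending both extra points to $\bot$. An element of $\mathbf{D}\mathbf{M}X$ is identified with a subdistribution, i.e. a finite formal sum $\sum_i\lambda_i|x_i\rangle$ over $X$ with $\lambda_i>0$ and $\sum_i\lambda_i\le 1$ (the missing mass is the coefficient of $\bot$). The zero formal sum $0$ stands for $|\bot\rangle\in\mathbf{D}\mathbf{M}X$ and also for $\bot\in\mathbf{M}\mathbf{D}X$. Normalization: $(\sum_i\lambda_i|x_i\rangle)^\circ=\sum_i\frac{\lambda_i}{\sum_k\lambda_k}|x_i\rangle$ if $\sum_k\lambda_k\neq0$, and $(0)^\circ=0$. Distributive law: given monads $(T,\mu^T,\eta^T)$ and $(S,\mu^S,\eta^S)$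 on a category, a distributive law of $T$ over $S$ is a natural transformation $\psi_X\colon TSX\to STX$ with (1) $\psi_X\circ\mu^T_{SX}=S(\mu^T_X)\circ\psi_{TX}\circ T(\psi_X)$; (2) $\psi_X\circ\eta^T_{SX}=S(\eta^T_X)$; (3) $\psi_X\circ T(\mu^S_X)=\mu^S_{TX}\circ S(\psi_X)\circ\psi_{SX}$; (4) $\psi_X\circ T(\eta^S_X)=\eta^S_{TX}$. *)

(* Defs.v *)
From HB Require Import structures.
From mathcomp Require Import all_boot all_order all_algebra.
From mathcomp Require Import finmap.
From mathcomp Require Import mathcomp_extra boolp classical_sets functions.
From mathcomp Require Import cardinality fsbigop reals.
Set Implicit Arguments.
Unset Strict Implicit.
Unset Printing Implicit Defensive.
Import Order.TTheory GRing.Theory Num.Theory.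
Local Open Scope classical_set_scope.
Local Open Scope ring_scope.

(* The category of sets is [Type] with functions; equality of morphisms is
   Leibniz equality of functions (function extensionality is assumed). *)

Record functor := Functor {
  fobj :> Type -> Type;
  fmap : forall X Y, (X -> Y) -> fobj X -> fobj Y;
  fmap_id : forall X, fmap (@id X) = id;
  fmap_comp : forall X Y Z (g : Y -> Z) (f : X -> Y),
    fmap (g \o f) = fmap g \o fmap f }.
Arguments fmap F {X Y} f : rename.

Definition id_functor : functor :=
  @Functor (fun X => X) (fun X Y f => f) (fun X => erefl)
    (fun X Y Z g f => erefl).

Lemma comp_fmap_id (F G : functor) X : fmap F (fmap G (@id X)) = id.
Proof. by rewrite !fmap_id. Qed.

Lemma comp_fmap_comp (F G : functor) X Y Z (g : Y -> Z) (f : X -> Y) :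
  fmap F (fmap G (g \o f)) = fmap F (fmap G g) \o fmap F (fmap G f).
Proof. by rewrite (fmap_comp G) (fmap_comp F). Qed.

(* [comp_functor F G] is X |-> F (G X) *)
Definition comp_functor (F G : functor) : functor :=
  @Functor (fun X => F (G X)) (fun X Y f => fmap F (fmap G f))
    (@comp_fmap_id F G) (@comp_fmap_comp F G).

Definition is_natural (F G : functor) (a : forall X, F X -> G X) : Prop :=
  forall X Y (f : X -> Y), fmap G f \o a X = a Y \o fmap F f.

Record monad := Monad {
  mfun :> functor;
  munit : forall X, X -> mfun X;
  mmult : forall X, mfun (mfun X) -> mfun X;
  munit_natural : is_natural (F := id_functor) (G := mfun) munit;
  mmult_natural : is_natural (F := comp_functor mfun mfun) (G := mfun) mmult;
  mmult_unitl : forall X, mmult (X := X) \o munit (X := mfun X) = id;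
  mmult_unitr : forall X, mmult (X := X) \o fmap mfun (munit (X := X)) = id;
  mmultA : forall X,
    mmult (X := X) \o fmap mfun (mmult (X := X)) =
    mmult (X := X) \o mmult (X := mfun X) }.
Arguments munit : clear implicits.
Arguments mmult : clear implicits.

Record is_distributive_law (T S : monad)
    (psi : forall X, T (S X) -> S (T X)) : Prop := IsDistributiveLaw {
  distr_natural :
    is_natural (F := comp_functor T S) (G := comp_functor S T) psi;
  distr_multl : forall X,
    psi X \o mmult T (S X) =
    fmap S (mmult T X) \o psi (T X) \o fmap T (psi X);
  distr_unitl : forall X,
    psi X \o munit T (S X) = fmap S (munit T X);
  distr_multr : forall X,
    psi X \o fmap T (mmult S X) =
    mmult S (T X) \o fmap S (psi X) \o psi (S X);
  distr_unitr : forall X,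
    psi X \o fmap T (munit S X) = munit S (T X) }.

(* The maybe monad, with [None] as the extra point. *)

Definition maybe_mult X (m : option (option X)) : option X :=
  if m is Some m' then m' else None.

Definition maybe_functor : functor.
Proof.
by refine (@Functor option omap _ _) => *; apply/funext; case.
Defined.

Definition maybe_monad : monad.
Proof.
refine (@Monad maybe_functor (@Some) maybe_mult _ _ _ _ _) =>
  [X Y f|X Y f|X|X|X]; apply/funext => //; by case=> // -[].
Defined.

(* A finite formal sum over X with positive weights of total 1, encoded by its
   coefficient function: the coefficient is 0 off the finite support.  The sum
   [\sum_(x \in _) _] over a set is that of fsbigop, for summands of finite
   support; [{classic X}] is X with a classical choice structure. *)
Record dist (R : realType) (X : Type) := Dist {
  coef :> X -> R;
  coef_ge0 : forall x, 0 <= coef x;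
  coef_finite : finite_set [set x | coef x != 0];
  coef_sum1 : \sum_(x \in [set: {classic X}]) coef x = 1 }.

Section Distribution.
Variable R : realType.
Implicit Types X Y Z : Type.

Lemma distP X (p q : dist R X) : (forall x, p x = q x) -> p = q.
Proof.
case: p q => [f f1 f2 f3] [g g1 g2 g3] /= /funext fg; subst g.
by congr Dist; exact: Prop_irrelevance.
Qed.

Definition supp X (p : dist R X) : {fset {classic X}} :=
  fset_set ([set x | p x != 0] : set {classic X}).

Lemma suppPn X (p : dist R X) (x : {classic X}) : x \notin supp p -> p x = 0.
Proof.
rewrite in_fset_set; last exact: coef_finite.
by move=> /negP h; apply/eqP/negPn/negP => px; apply: h; rewrite inE.
Qed.

Definition expect X (p : dist R X) (g : X -> R) : R :=
  \sum_(x \in [set: {classic X}]) p x * g x.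

Lemma expectE X (p : dist R X) g (A : {fset {classic X}}) :
  (forall x, x \notin A -> p x = 0) ->
  expect p g = \sum_(x <- A) p x * g x.
Proof. by move=> pA; apply: fsbigTE => x /pA ->; rewrite mul0r. Qed.

Lemma expect1 X (p : dist R X) : expect p (fun=> 1) = 1.
Proof.
by rewrite -[RHS](coef_sum1 p); apply: eq_fsbigr => x _; rewrite mulr1.
Qed.

Lemma eq_expect X (p : dist R X) g h : g =1 h -> expect p g = expect p h.
Proof. by move=> /funext ->. Qed.

Definition unit_coef X (x : X) (y : X) : R := if `[< y = x >] then 1 else 0.

Lemma unit_coef_ge0 X (x y : X) : 0 <= unit_coef x y.
Proof. by rewrite /unit_coef; case: ifP. Qed.

Lemma unit_coef_finite X (x : X) : finite_set [set y | unit_coef x y != 0].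
Proof.
apply: (@sub_finite_set _ _ [set x]); last exact: finite_set1.
by move=> y /=; rewrite /unit_coef; case: asboolP => //; rewrite eqxx.
Qed.

Lemma unit_sum X (x : X) (g : X -> R) :
  \sum_(y \in [set: {classic X}]) unit_coef x y * g y = g x.
Proof.
rewrite (@fsbigTE _ _ _ _ [fset (x : {classic X})]%fset).
  by rewrite big_seq_fset1 /unit_coef asboolT// mul1r.
move=> y; rewrite in_fset1 => /eqP yx.
by rewrite /unit_coef asboolF// mul0r.
Qed.

Lemma unit_coef_sum1 X (x : X) :
  \sum_(y \in [set: {classic X}]) unit_coef x y = 1.
Proof.
by rewrite -[RHS](unit_sum x (fun=> 1)); apply: eq_fsbigr => y _; rewrite mulr1.
Qed.

Definition dist_unit X (x : X) : dist R X :=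
  Dist (unit_coef_ge0 x) (unit_coef_finite x) (unit_coef_sum1 x).

Lemma expect_unit X (x : X) g : expect (dist_unit x) g = g x.
Proof. exact: unit_sum. Qed.

Section Bind.
Variables (X Y : Type) (p : dist R X) (k : X -> dist R Y).

Let f (y : Y) := expect p (fun x => k x y).

Lemma bind_ge0 y : 0 <= f y.
Proof. by apply: fsumr_ge0 => x _; rewrite mulr_ge0// coef_ge0. Qed.

Let B : set {classic Y} :=
  \bigcup_(x in [set x | p x != 0]) [set y | k x y != 0].

Let Bfin : finite_set B.
Proof.
by apply: bigcup_finite => [|x _]; exact: coef_finite.
Qed.

Let notB x y : p x != 0 -> y \notin fset_set B -> k x y = 0.
Proof.
move=> px; rewrite in_fset_set// => /negP yB; apply/eqP/negPn/negP => kxy.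
by apply: yB; rewrite inE; exists x.
Qed.

Let f0 (y : {classic Y}) : y \notin fset_set B -> f y = 0.
Proof.
move=> yB; apply: fsbig1 => x _; have [->|px] := eqVneq (p x) 0.
  by rewrite mul0r.
by rewrite (notB px yB) mulr0.
Qed.

Lemma bind_finite : finite_set [set y | f y != 0].
Proof.
apply: sub_finite_set Bfin => y /= fy.
by apply: contrapT => yB; move/negP: fy; apply; apply/eqP/f0;
  rewrite in_fset_set//; apply/negP; rewrite inE.
Qed.

Lemma bind_sum (g : Y -> R) :
  \sum_(y \in [set: {classic Y}]) f y * g y =
  expect p (fun x => expect (k x) g).
Proof.
rewrite (@fsbigTE _ _ _ _ (fset_set B)); last first.
  by move=> y /f0 ->; rewrite mul0r.
rewrite (expectE _ (@suppPn _ p)).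
under eq_bigr => y _ do rewrite /f (expectE _ (@suppPn _ p)) mulr_suml.
rewrite exchange_big /=; apply: eq_bigr => x _.
have [->|px] := eqVneq (p x) 0.
  by rewrite mul0r big1// => y _; rewrite !mul0r.
rewrite (@expectE _ (k x) g (fset_set B)); last by move=> y; exact: notB.
by rewrite mulr_sumr; apply: eq_bigr => y _; rewrite mulrA.
Qed.

Lemma bind_sum1 : \sum_(y \in [set: {classic Y}]) f y = 1.
Proof.
transitivity (\sum_(y \in [set: {classic Y}]) f y * 1).
  by apply: eq_fsbigr => y _; rewrite mulr1.
rewrite (bind_sum (fun=> 1)) -[RHS](expect1 p).
by apply: eq_expect => x; rewrite expect1.
Qed.

End Bind.

(* f_*(sum_i lambda_i |x_i>) = sum_i lambda_i |f(x_i)> *)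
Definition map_coef X Y (f : X -> Y) (p : dist R X) (y : Y) : R :=
  \sum_(x \in (f @^-1` [set y] : set {classic X})) p x.

Lemma map_coefE X Y (f : X -> Y) (p : dist R X) :
  map_coef f p = fun y => expect p (fun x => dist_unit (f x) y).
Proof.
apply/funext => y; rewrite /map_coef fsbig_mkcond; apply: eq_fsbigr => x _.
rewrite /patch /= /unit_coef; case: asboolP => [->|yfx].
  by rewrite mulr1 ifT// in_setE.
by rewrite mulr0 ifF//; apply/negP; rewrite in_setE => /esym.
Qed.

Lemma map_coef_ge0 X Y (f : X -> Y) (p : dist R X) y : 0 <= map_coef f p y.
Proof. by rewrite map_coefE bind_ge0. Qed.

Lemma map_coef_finite X Y (f : X -> Y) (p : dist R X) :
  finite_set [set y | map_coef f p y != 0].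
Proof. by rewrite map_coefE; exact: bind_finite. Qed.

Lemma map_coef_sum1 X Y (f : X -> Y) (p : dist R X) :
  \sum_(y \in [set: {classic Y}]) map_coef f p y = 1.
Proof. by rewrite map_coefE; exact: bind_sum1. Qed.

Definition dist_map X Y (f : X -> Y) (p : dist R X) : dist R Y :=
  Dist (map_coef_ge0 f p) (map_coef_finite f p) (map_coef_sum1 f p).

Lemma expect_map X Y (f : X -> Y) p g :
  expect (dist_map f p) g = expect p (g \o f).
Proof.
rewrite /expect /= map_coefE bind_sum.
by apply: eq_expect => x; rewrite expect_unit.
Qed.

Definition mult_coef X (P : dist R (dist R X)) (x : X) : R :=
  \sum_(p \in [set: {classic (dist R X)}]) P p * (p : dist R X) x.

Definition dist_mult X (P : dist R (dist R X)) : dist R X :=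
  @Dist R X (mult_coef P) (bind_ge0 P id) (bind_finite P id) (bind_sum1 P id).

Lemma expect_mult X (P : dist R (dist R X)) g :
  expect (dist_mult P) g = expect P (fun p => expect p g).
Proof. exact: (bind_sum P id g). Qed.

Lemma expect_inj X (p q : dist R X) : expect p =1 expect q -> p = q.
Proof.
move=> pq; apply: distP => x.
have E (r : dist R X) : expect r (unit_coef x) = r x.
  rewrite -[RHS](expect_unit x r).
  by apply: eq_fsbigr => y _; rewrite mulrC.
by rewrite -!E pq.
Qed.

Definition expect_simp := (expect_map, expect_unit, expect_mult).

Definition dist_functor : functor.
Proof.
refine (@Functor (dist R) dist_map _ _) => *; apply/funext => p;
  by apply: expect_inj => h; rewrite /= !expect_simp.
Defined.

Definition dist_monad : monad.
Proof.
refine (@Monad dist_functor dist_unit dist_mult _ _ _ _ _) =>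
  [X Y f|X Y f|X|X|X]; apply/funext => p; apply: expect_inj => h; rewrite /= !expect_simp//=;
  by apply: eq_expect => q /=; rewrite !expect_simp.
Defined.

(* The subdistribution on X underlying p : dist R (option X) is
   x |-> p (Some x); [mass p] is its total weight. *)
Definition mass X (p : dist R (option X)) : R :=
  \sum_(x \in [set: {classic X}]) p (Some x).

Section Normalize.
Variables (X : Type) (p : dist R (option X)) (mp : mass p <> 0).

Definition norm_coef (x : X) : R := p (Some x) / mass p.

Lemma norm_coef_ge0 x : 0 <= norm_coef x.
Proof.
by rewrite divr_ge0 ?coef_ge0//; apply: fsumr_ge0 => y _; exact: coef_ge0.
Qed.

Lemma norm_coef_finite : finite_set [set x | norm_coef x != 0].
Proof.
apply: (@sub_finite_set _ _ (Some @^-1` [set x | p x != 0])).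
  by move=> x /=; apply: contra_neq; rewrite /norm_coef => ->; rewrite mul0r.
by apply: finite_preimage; [move=> x y _ _ [] | exact: coef_finite].
Qed.

Lemma norm_coef_sum1 : \sum_(x \in [set: {classic X}]) norm_coef x = 1.
Proof. by rewrite -mulr_fsuml divff//; exact/eqP. Qed.

Definition norm_dist : dist R X :=
  Dist norm_coef_ge0 norm_coef_finite norm_coef_sum1.

End Normalize.

Definition normalization X (p : dist R (option X)) : option (dist R X) :=
  match pselect (mass p = 0) with
  | left _ => None
  | right mp => Some (norm_dist mp)
  end.

End Distribution.

(* Main.v *)
Require Import Defs.
From mathcomp Require Import all_boot all_order all_algebra.
From mathcomp Require Import finmap.
From mathcomp Require Import boolp classical_sets.
From mathcomp Require Import cardinality fsbigop reals.
Import GRing.Theory Num.Theory.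
Local Open Scope classical_set_scope.
Local Open Scope ring_scope.

(** Normalization fails the law that makes it compatible with the
    multiplication of the distribution monad.  Mix, with weights 1/2 and 1/2,
    the subdistribution 1/2 |true> and the distribution |false>.  Normalizing
    each component first turns them into |true> and |false>, and their mixture
    is the fair coin.  Mixing first gives 1/4 |true> + 1/2 |false>, whose
    normalization 1/3 |true> + 2/3 |false> is biased: the component that lost
    mass contributes less weight, and rescaling the total cannot restore it.

    Distributions are handled through their expectation functionals, which
    determine them ([expect_inj]) and turn the monad operations into
    substitutions.  In these terms, normalization rescales the functional
    g |-> E[g extended by 0] by the reciprocal of its value at g = 1
    ([expect_normalization]), and any distribution whose functional is
    proportional to this one is the normalization ([normalization_Some]).  The
    bias is detected by the function +1 at true, -1 at false, to which the fair
    coin gives expectation 0. *)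

(** Extending g by 0 at the extra point makes integration against a
    subdistribution a genuine expectation over [option X], to which the
    computation rules for expectations apply. *)
Lemma expect_oapp (R : realType) (X : Type) (p : dist R (option X))
    (g : X -> R) :
  expect p (oapp g 0) = \sum_(x \in [set: {classic X}]) p (Some x) * g x.
Proof.
rewrite /expect -(@fsbig_widen _ _ _ _
  ((Some : {classic X} -> {classic option X}) @` setT)) //; last first.
  by move=> [x|] [_ /= nx]; [case: nx; exists x | rewrite mulr0].
by rewrite fsbig_image // => x y _ _ [].
Qed.

Lemma mass_expect (R : realType) (X : Type) (p : dist R (option X)) :
  mass p = expect p (oapp (fun=> 1) 0).
Proof. by rewrite expect_oapp; apply: eq_fsbigr => x _; rewrite mulr1. Qed.

Lemma expect_normalization (R : realType) (X : Type) (p : dist R (option X))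
    (r : dist R X) (g : X -> R) :
  normalization p = Some r -> expect p (oapp g 0) = mass p * expect r g.
Proof.
rewrite /normalization; case: pselect => // mp [<-].
rewrite expect_oapp /expect mulr_fsumr; apply: eq_fsbigr => x _ /=.
by rewrite /norm_coef mulrA mulrCA mulfV ?mulr1//; exact/eqP.
Qed.

(** The factor c is forced to be the mass of p, as g = 1 shows; leaving it free
    spares computing the mass of each example separately. *)
Lemma normalization_Some (R : realType) (X : Type) (p : dist R (option X))
    (r : dist R X) (c : R) :
  c != 0 -> (forall g, expect p (oapp g 0) = c * expect r g) ->
  normalization p = Some r.
Proof.
move=> c0 pr; have mc : mass p = c by rewrite mass_expect pr expect1 mulr1.
case np: (normalization p) => [q|]; last first.
  by move: np; rewrite /normalization; case: pselect => //;
    rewrite mc => /eqP; rewrite (negPf c0).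
congr Some; apply: expect_inj => g; apply: (mulfI c0).
by rewrite -pr (expect_normalization _ _ _ _ _ np) mc.
Qed.

Lemma half_ge0 (R : realType) (b : bool) : 0 <= 2^-1 :> R.
Proof. by rewrite invr_ge0 ler0n. Qed.

Lemma half_neq0 (R : realType) : 2^-1 != 0 :> R.
Proof. by rewrite invr_eq0 pnatr_eq0. Qed.

Lemma sum_bool (R : realType) (f : bool -> R) :
  \sum_(b \in [set: {classic bool}]) f b = f true + f false.
Proof.
rewrite (@fsbigTE _ _ _ _ [fset (true : {classic bool}); (false : {classic bool})]%fset).
  by rewrite big_fsetU1 ?big_seq_fset1// in_fset1; apply/eqP.
by case; rewrite !inE ?eqxx ?orbT.
Qed.

Lemma sum_half (R : realType) :
  \sum_(b \in [set: {classic bool}]) (2^-1 : R) = 1.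
Proof. by rewrite (sum_bool _ (fun=> 2^-1)) [RHS]splitr mul1r. Qed.

Definition coin (R : realType) : dist R bool :=
  @Dist R bool (fun=> 2^-1) (half_ge0 R)
    (@finite_finset bool [set b | 2^-1 != 0 :> R]) (sum_half R).

Lemma expect_coin (R : realType) (g : bool -> R) :
  expect (coin R) g = 2^-1 * g true + 2^-1 * g false.
Proof. exact: sum_bool (fun b => coin R b * g b). Qed.

(** For b = true this is the subdistribution 1/2 |true>: the image of the fair
    coin that sends tails to the extra point. *)
Definition lossy (R : realType) (b : bool) : dist R (option bool) :=
  if b then dist_map (fun c => if c then Some true else None) (coin R)
  else dist_unit R (Some false).

Lemma normalization_lossy (R : realType) (b : bool) :
  normalization (lossy R b) = Some (dist_unit R b).
Proof.
case: b; [apply: (@normalization_Some _ _ _ _ 2^-1) => [|g]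
         |apply: (@normalization_Some _ _ _ _ 1) => [|g]];
  rewrite ?half_neq0 ?oner_eq0 //= !expect_simp ?expect_coin /=.
- by rewrite mulr0 addr0.
- by rewrite mul1r.
Qed.

Theorem theorem2p10 (R : realType) :
  ~ is_distributive_law (T := dist_monad R) (S := maybe_monad)
      (@normalization R).
Proof.
case=> _ /(_ bool) + _ _ _.
move=> /(congr1 (@^~ (dist_map (lossy R) (coin R)))) /=.
rewrite (@normalization_Some _ _ _ (dist_map (@dist_unit R bool) (coin R)) 1)
  ?oner_eq0 //; last first.
  by move=> g; rewrite !expect_simp mul1r; apply: eq_expect => b /=;
    rewrite normalization_lossy.
have -> : omap (@dist_mult R bool) (Some (dist_map (@dist_unit R bool) (coin R)))
    = Some (coin R).
  by congr Some; apply: expect_inj => g; rewrite !expect_simp;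
    apply: eq_expect => b /=; rewrite expect_unit.
move=> /(expect_normalization _ _ _ _ (fun b : bool => if b then 1 else -1)).
rewrite !expect_simp !expect_coin /= !expect_simp expect_coin /=.
(* The fair coin gives 0 to this function; the lossy mixture gives 1/4 - 1/2. *)
rewrite !mulr1 mulr0 addr0 mulrN1 subrr mulr0 => /eqP.
rewrite subr_eq0 -[X in _ == X]mulr1 => /eqP /(mulfI (half_neq0 R)) /eqP.
by rewrite invr_eq1 -[1]/(1%:R) eqr_nat.
Qed.
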